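(* Let $\alpha\ge3$ and $\kappa\ge\omega$ be cardinals, and let $\{X_i:i\in I\}$ be a set of topological spaces such that $|I|^+\ge\kappa$ and $3\le S(X_i)\le\alpha^+$ for each $i\in I$. If $\alpha^+\le\kappa$ then $S((X_I)_\kappa)=(2^{<\kappa})^+$.
   Context: No separation axioms are assumed. A cellular family in $X$ is a family of pairwise disjoint nonempty open subsets of $X$; the Souslin number $S(X)$ is the least cardinal $\lambda$ (possibly finite) such that no cellular family in $X$ has cardinality $\lambda$. For an infinite cardinal $\kappa$, $(X_I)_\kappa$ is $X_I:=\prod_{i\in I}X_i$ with the $\kappa$-box topology, whose base consists of all sets $\prod_{i\in I}U_i$ with each $U_i$ open in $X_i$ and $|\{i\in I:U_i\ne X_i\}|<\kappa$. $2^{<\kappa}:=\sum_{\lambda<\kappa}2^\lambda$ (sum over cardinals $\lambda<\kappa$). For a cardinal $\gamma$ (finite or infinite), $\gamma^+$ is the least cardinal greater than $\gamma$. *)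

(* Defs.v *)
From HB Require Import structures.
From mathcomp Require Import all_boot all_classical topology.

Set Implicit Arguments.
Unset Strict Implicit.
Unset Printing Implicit Defensive.

Local Open Scope classical_set_scope.
Local Open Scope card_scope.

(* A cardinal is an equipotence class of types in a fixed universe, so that
   Leibniz equality of cardinals is equipotence (lemma cardE). *)
Definition equipotent (T U : Type) : Prop := [set: T] #= [set: U].

Record cardinal := Cardinal {
  cardinal_class : Type -> Prop;
  cardinal_classP : exists T, cardinal_class = equipotent T }.

Definition cardinal_of (T : Type) : cardinal :=
  Cardinal (ex_intro (fun U => equipotent T = equipotent U) T erefl).

Definition carrier (a : cardinal) : Type := sval (cid (cardinal_classP a)).

Definition cle (a b : cardinal) : Prop := [set: carrier a] #<= [set: carrier b].
Definition clt (a b : cardinal) : Prop := cle a b /\ a <> b.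

Declare Scope cardinal_scope.
Delimit Scope cardinal_scope with cardinal.
Bind Scope cardinal_scope with cardinal.
Notation "a <= b" := (cle a b) : cardinal_scope.
Notation "a < b" := (clt a b) : cardinal_scope.
Local Open Scope cardinal_scope.

Definition is_least (P : cardinal -> Prop) (a : cardinal) : Prop :=
  P a /\ forall b, P b -> a <= b.

(* The default value is only returned for an empty P: see leastP. *)
Definition least (P : cardinal -> Prop) : cardinal :=
  if pselect (exists a, is_least P a) is left e then sval (cid e)
  else cardinal_of void.

Definition cnat (n : nat) : cardinal := cardinal_of 'I_n.
Definition aleph0 : cardinal := cardinal_of nat.
Definition csucc (a : cardinal) : cardinal := least (fun b => a < b).
Definition cpow2 (a : cardinal) : cardinal := cardinal_of (set (carrier a)).
Definition csum (J : Type) (f : J -> cardinal) : cardinal :=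
  cardinal_of {j : J & carrier (f j)}.

(* The cardinals l < a do not form a type in the universe of [carrier a]; each of
   them is coded by the set of all subsets of [carrier a] of cardinality l. *)
Definition below (a : cardinal) : Type :=
  {C : set (set (carrier a)) | exists l : cardinal,
     l < a /\ C = [set A : set (carrier a) | cardinal_of A = l]}.
Definition below_val (a : cardinal) (C : below a) : cardinal :=
  sval (cid (svalP C)).

Definition cpow2_lt (a : cardinal) : cardinal :=
  csum (fun l : below a => cpow2 (below_val l)).

Definition cellular (X : topologicalType) (F : set (set X)) : Prop :=
  (forall U, F U -> open U /\ U !=set0) /\ trivIset F id.

(* A cellular family is a set F of open sets, not an indexed family, so that its
   cardinality is that of F. *)
Definition souslin (X : topologicalType) : cardinal :=
  least (fun a => ~ exists F : set (set X), cellular F /\ cardinal_of F = a).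

Section CardinalTheory.

Lemma cardinal_ext (a b : cardinal) :
  cardinal_class a = cardinal_class b -> a = b.
Proof.
case: a b => [P pP] [Q pQ] /= PQ; rewrite -PQ in pQ *.
by congr Cardinal; exact: Prop_irrelevance.
Qed.

Lemma cardE (T U : Type) : cardinal_of T = cardinal_of U <-> [set: T] #= [set: U].
Proof.
split=> [e|TU].
  have : cardinal_class (cardinal_of T) U by rewrite e; exact: card_eqxx.
  by [].
apply: cardinal_ext; apply/funext => V; apply/propext.
by rewrite /= /equipotent; split=> h;
   [rewrite -(card_eql TU)|rewrite (card_eql TU)].
Qed.

Lemma carrierK (a : cardinal) : cardinal_of (carrier a) = a.
Proof. by rewrite /carrier; case: cid => T aT; exact: cardinal_ext. Qed.

Lemma carrier_cardinal_of (T : Type) : [set: carrier (cardinal_of T)] #= [set: T].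
Proof. by apply/cardE; rewrite carrierK. Qed.

Lemma cle_card (T U : Type) : cardinal_of T <= cardinal_of U <-> [set: T] #<= [set: U].
Proof.
by rewrite /cle (card_le_eql (carrier_cardinal_of T)) (card_le_eqr (carrier_cardinal_of U)).
Qed.

Lemma cle_cardS (T U : Type) (A : set T) (B : set U) :
  cardinal_of A <= cardinal_of B <-> A #<= B.
Proof.
split=> [/cle_card|AB]; last apply/cle_card;
  by rewrite (card_le_eql (card_setT A)) (card_le_eqr (card_setT B)).
Qed.

Lemma cle_refl (a : cardinal) : a <= a.
Proof. exact: card_lexx. Qed.

Lemma cle_trans (b a c : cardinal) : a <= b -> b <= c -> a <= c.
Proof. exact: card_le_trans. Qed.

Lemma cle_anti (a b : cardinal) : a <= b -> b <= a -> a = b.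
Proof.
by move=> ab ba; rewrite -(carrierK a) -(carrierK b); apply/cardE/Cantor_Bernstein.
Qed.

Lemma card_le_rel (T U : Type) (A : set T) (B : set U) (R : T -> U -> Prop) :
  (forall x, A x -> exists2 y, B y & R x y) ->
  (forall x x' y, A x -> A x' -> R x y -> R x' y -> x = x') -> A #<= B.
Proof.
move=> AB Rinj.
have /choice[f fP] : forall x : A, exists y : B, R (val x) (val y).
  by case=> x Ax; have [y By Rxy] := AB _ (set_mem Ax); exists (SigSub (mem_set By)).
apply/card_leP/injfunPex; exists f => // x x' _ _ e.
apply/val_inj/(Rinj _ _ (val (f x))); [exact: set_valP|exact: set_valP|exact: fP|].
by rewrite e; exact: fP.
Qed.

Lemma card_le_relP (T U : Type) (A : set T) (B : set U) : A #<= B ->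
  exists R : T -> U -> Prop, (forall x, A x -> exists2 y, B y & R x y) /\
  (forall x x' y, A x -> A x' -> R x y -> R x' y -> x = x').
Proof.
move=> /card_leP/injfunPex[f _ finj].
exists (fun x y => exists Ax : x \in A, val (f (SigSub Ax)) = y); split.
  move=> x /mem_set Ax; exists (val (f (SigSub Ax))); first exact: set_valP.
  by exists Ax.
move=> x x' y _ _ [Ax <-] [Ax' /val_inj/finj e].
by have /(congr1 val) := e (mem_set I) (mem_set I).
Qed.

Lemma card_min_family (J : Type) (T : J -> Type) : inhabited J ->
  exists i, forall j, [set: T i] #<= [set: T j].
Proof.
move=> [j0].
pose P (D : set (forall i, T i)) :=
  forall f g i, D f -> D g -> f i = g i -> f = g.
have [|D [DP Dmax]] := @Zorn_bigcup _ P.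
  move=> F FP Ftot f g i [D FD Df] [E FE Eg].
  have [DE|ED] := Ftot _ _ FD FE.
    by apply: (FP _ FE) => //; exact: DE.
  by apply: (FP _ FD) => //; exact: ED.
have [i Di] : exists i, forall t : T i, exists2 f, D f & f i = t.
  apply: contrapT => /forallNP nD.
  have g i : {t : T i | forall f, D f -> f i <> t}.
    apply: cid; have /existsNP[t tP] := nD i.
    by exists t => f Df fi; apply: tP; exists f.
  pose f0 i := sval (g i); have f0P i := svalP (g i).
  apply: (Dmax (f0 |` D)).
    split; first by move=> f Df; right.
    by move=> /(_ f0 (or_introl erefl)) /(f0P j0); apply.
  move=> f h i [->|Df] [->|Dh]; [by []| | |exact: DP].
    by move=> e; have := f0P i h Dh; rewrite -e.
  by move=> e; have := f0P i f Df; rewrite e.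
exists i => j.
apply: (@card_le_rel _ _ _ _ (fun t u => exists2 f, D f & f i = t /\ f j = u)).
  by move=> t _; have [f Df fi] := Di t; exists (f j) => //; exists f.
move=> _ _ u _ _ [f Df [<- fu]] [h Dh [<- hu]].
by rewrite (DP f h j) // fu hu.
Qed.

Lemma card_le_total (T U : Type) :
  [set: T] #<= [set: U] \/ [set: U] #<= [set: T].
Proof.
have [[] h] := @card_min_family bool (fun b => if b then T else U)
  (inhabits true); [left; exact: (h false)|right; exact: (h true)].
Qed.

Lemma cle_total (a b : cardinal) : a <= b \/ b <= a.
Proof. exact: card_le_total. Qed.

Lemma cltNge (a b : cardinal) : a < b <-> ~ b <= a.
Proof.
split=> [[ab ne] ba|nba]; first by apply: ne; exact: cle_anti.
have [ab|//] := cle_total a b; split=> // e.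
by apply: nba; rewrite e; exact: cle_refl.
Qed.

Lemma cle_subset (b a : cardinal) :
  b <= a -> exists A : set (carrier a), cardinal_of A = b.
Proof.
move=> ba; have [R [RT Rinj]] := card_le_relP ba.
have /choice[f fP] : forall x, exists y, R x y.
  by move=> x; have [y _ Rxy] := RT x Logic.I; exists y.
exists (range f); rewrite -[RHS]carrierK; apply/cardE.
rewrite (card_eql (card_setT _)); apply: inj_card_eq => x y _ _ e.
by apply: (Rinj _ _ (f x)) => //; rewrite e.
Qed.

Lemma leastP (P : cardinal -> Prop) (a : cardinal) :
  P a -> is_least P (least P).
Proof.
move=> Pa; rewrite /least; case: pselect => [e|]; first exact: svalP.
case.
have Pa' : P (cardinal_of [set: carrier a]).
  by rewrite (_ : cardinal_of _ = a)// -[RHS]carrierK; apply/cardE/card_setT.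
have [[A PA] Amin] :=
  @card_min_family {A : set (carrier a) | P (cardinal_of A)} (fun A => sval A)
    (inhabits (exist _ _ Pa')).
exists (cardinal_of A); split=> // b Pb.
have [/cle_subset[B eb]|ab] := cle_total b a.
  rewrite -eb in Pb *.
  exact/cle_card/(Amin (exist _ _ Pb)).
apply: cle_trans ab.
have := Amin (exist _ _ Pa'); rewrite /= -cle_card => h; apply: cle_trans h _.
by rewrite -[X in _ <= X]carrierK; apply/cle_card; rewrite (card_le_eql (card_setT _)).
Qed.

Lemma clt_cpow2 (a : cardinal) : a < cpow2 a.
Proof.
apply/cltNge => /(card_le_trans _).
move/(_ _ [set: set (carrier a)]); rewrite (card_le_eqr (carrier_cardinal_of _)).
move=> /(_ (card_lexx _))/card_le_relP[R [RT Rinj]].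
pose D := [set y | exists2 A : set (carrier a), R A y & ~ A y].
have [y _ Ry] := RT D Logic.I.
have nDy : ~ D y.
  by move=> Dy; have [A RAy] := Dy; rewrite (Rinj _ _ y _ _ RAy Ry).
by apply: (nDy); exists D.
Qed.

Lemma csuccP (a : cardinal) : is_least (fun b => a < b) (csucc a).
Proof. exact: leastP (clt_cpow2 a). Qed.

Lemma souslinP (X : topologicalType) :
  is_least (fun a => ~ exists F : set (set X), cellular F /\ cardinal_of F = a)
    (souslin X).
Proof.
apply: (@leastP _ (cpow2 (cardinal_of (set X)))) => -[F [_ eF]].
have := clt_cpow2 (cardinal_of (set X)); rewrite -eF => /cltNge; apply.
by apply/cle_card; rewrite (card_le_eql (card_setT F)) card_leT.
Qed.

Lemma below_valP (a : cardinal) (l : below a) : below_val l < a /\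
  sval l = [set A : set (carrier a) | cardinal_of A = below_val l].
Proof. exact: svalP (cid (svalP l)). Qed.

Lemma below_val_inj (a : cardinal) : injective (@below_val a).
Proof.
move=> l m lm; suff : sval l = sval m.
  by case: l m {lm} => [C lC] [D lD] /= CD; exact: eq_exist.
by rewrite (below_valP l).2 (below_valP m).2 lm.
Qed.

Lemma below_val_surj (a b : cardinal) :
  b < a -> exists l : below a, below_val l = b.
Proof.
move=> ba; have [A eA] := cle_subset ba.1.
pose l : below a := exist _ _ (ex_intro _ b (conj ba erefl)).
exists l; have [_ lE] := below_valP l.
have : [set B : set (carrier a) | cardinal_of B = below_val l] A by rewrite -lE.
by move=> /= <-.
Qed.

Lemma infinite_double (T : Type) :
  infinite_set [set: T] -> [set: T * bool] #<= [set: T].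
Proof.
move=> Tinf.
have [E [/= Enat Etriv Emax]] := @ex_maximal_disjoint_subcollection
  (set T) T id [set S | S #= [set: nat]].
pose W := \bigcup_(S in E) S.
have Rfin : finite_set (~` W).
  apply: contrapT => /infiniteP/card_subP[S SN SW].
  have nES : ~ E S.
    move=> ES; have S0 : S = set0.
      rewrite -subset0 => x Sx; apply: (SW _ Sx); by exists S.
    by apply: infinite_nat; rewrite -(eq_finite_set SN) S0.
  apply: (Emax (S |` E)).
  - by split; [move=> A EA; right|move=> /(_ S (or_introl erefl))].
  - by move=> A [->//|]; exact: Enat.
  move=> A B [->|EA] [->|EB] //; last exact: Etriv.
    by move=> [x [/SW nWx Bx]]; case: nWx; exists B.
  by move=> [x [Ax /SW nWx]]; case: nWx; exists A.
have Winf : infinite_set W.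
  by move=> Wfin; apply: Tinf; rewrite -(setUv W) finite_setU.
have Wdouble : W `*` [set: bool] #<= W.
  have /choice[g gP] : forall S : set T, exists R : T * bool -> T -> Prop,
      E S -> (forall x, (S `*` [set: bool]) x -> exists2 y, S y & R x y) /\
      (forall x x' y, (S `*` [set: bool]) x -> (S `*` [set: bool]) x' ->
        R x y -> R x' y -> x = x').
    move=> S; have [ES|] := pselect (E S); last by exists (fun _ _ => True).
    have : S `*` [set: bool] #<= S.
      apply: (@card_le_trans _ _ _ [set: nat]).
        by apply: countableX; [rewrite (eq_countable (Enat _ ES))|]; exact: countableP.
      by have /card_eqPle[] := Enat _ ES.
    by move=> /card_le_relP[R RP]; exists R.
  apply: (@card_le_rel _ _ _ _ (fun x y => exists S, [/\ E S, S x.1, S y & g S x y])).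
    move=> [t b] [/= [S ES St] _].
    have [y Sy gxy] := (gP _ ES).1 (t, b) (conj St Logic.I).
    by exists y; [exists S|exists S].
  move=> x x' y _ _ [S [ES Sx Sy gx]] [S' [ES' Sx' Sy' gx']].
  have e : S' = S by apply: Etriv => //; exists y.
  by rewrite e in Sx' gx'; apply: (gP _ ES).2 gx gx'.
have WRW : ~` W #<= W.
  apply: card_le_trans (proj1 (infiniteP _) Winf).
  exact: finite_set_countable.
have TW : [set: T] #<= W.
  apply: card_le_trans Wdouble.
  have [R [RT Rinj]] := card_le_relP WRW.
  apply: (@card_le_rel _ _ _ _ (fun x y =>
    (W x /\ y = (x, true)) \/ (~ W x /\ R x y.1 /\ y.2 = false))).
    move=> x _; have [Wx|nWx] := pselect (W x).
      by exists (x, true) => //; left.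
    by have [y Wy Rxy] := RT _ nWx; exists (y, false) => //; right.
  move=> x x' [y b] _ _ /= [[Wx [-> ->]]|[nWx [Rx ->]]] [[Wx' []//]|[nWx' [Rx' e]]].
    by [].
  exact: Rinj Rx Rx'.
apply: (card_le_trans _ (card_leT W)); apply: card_le_trans Wdouble.
have [R [RT Rinj]] := card_le_relP TW.
apply: (@card_le_rel _ _ _ _ (fun x y => R x.1 y.1 /\ x.2 = y.2)).
  by move=> [t b] _; have [y Wy Rty] := RT t Logic.I; exists (y, b).
by move=> [t b] [t' b'] [y c] _ _ /= [Rt ->] [Rt' ->]; rewrite (Rinj _ _ y _ _ Rt Rt').
Qed.

Lemma clt_subset (T : Type) (A B : set T) (k : cardinal) :
  A `<=` B -> cardinal_of B < k -> cardinal_of A < k.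
Proof.
move=> AB /cltNge Bk; apply/cltNge => kA; apply: Bk; apply: cle_trans kA _.
exact/cle_cardS/subset_card_le.
Qed.

Lemma clt_setU (T : Type) (A B : set T) (k : cardinal) :
  aleph0 <= k -> cardinal_of A < k -> cardinal_of B < k -> cardinal_of (A `|` B) < k.
Proof.
move=> kinf; wlog BA : A B / B #<= A => [wl|] Ak Bk.
  have [BA|AB] := cle_total (cardinal_of B) (cardinal_of A); first by apply: wl => //; exact/cle_cardS.
  by rewrite setUC; apply: wl => //; exact/cle_cardS.
have [Afin|Ainf] := pselect (finite_set A).
  have ABfin : finite_set (A `|` B).
    by rewrite finite_setU; split=> //; exact: card_le_finite Afin.
  apply/cltNge => /(cle_trans kinf)/cle_card; rewrite (card_le_eqr (card_setT _)).
  by move=> /infiniteP.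
apply/cltNge => kAB; case/cltNge: Ak; apply: cle_trans kAB _; apply/cle_cardS.
have /infinite_double AA : infinite_set [set: A] by rewrite (eq_finite_set (card_setT A)).
rewrite -(card_le_eqr (card_setT A)); apply: card_le_trans AA.
have [R [RB Rinj]] := card_le_relP BA.
apply: (@card_le_rel _ _ _ _ (fun x (y : A * bool) => (y.2 /\ val y.1 = x) \/
   (~~ y.2 /\ B x /\ R x (val y.1)))).
  move=> x [Ax|Bx]; first by exists (SigSub (mem_set Ax), true) => //; left.
  have [y Ay Rxy] := RB _ Bx.
  by exists (SigSub (mem_set Ay), false) => //; right.
move=> x x' [y []] _ _ /= [[// _ <-]|[// _ [Bx Rx]]] [[// _ <-//]|[// _ [Bx' Rx']]].
exact: Rinj Rx Rx'.
Qed.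

End CardinalTheory.

Section BoxProduct.
Variables (k : cardinal) (kinf : aleph0 <= k).
Variables (I : Type) (X : I -> topologicalType).

(* The k-box topology lives on this alias of the dependent product.  It takes
   the infinity of k as an argument because the boxes form a base only then:
   box_join needs a union of two sets of cardinality < k to be of
   cardinality < k. *)
Definition boxprod of aleph0 <= k : Type := forall i, X i.

HB.instance Definition _ := gen_eqMixin (boxprod kinf).
HB.instance Definition _ := gen_choiceMixin (boxprod kinf).

Definition box (U : forall i, set (X i)) : set (boxprod kinf) :=
  [set x | forall i, U i (x i)].

Definition box_base : set (set (boxprod kinf)) :=
  [set B | exists U : forall i, set (X i),
    [/\ forall i, open (U i), cardinal_of [set i | U i <> setT] < k & B = box U]].

Let box_cover : \bigcup_(B in box_base) B = setT.
Proof.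
apply/seteqP; split=> // x _; exists setT => //.
exists (fun=> setT); split; [by move=> i; exact: openT| |by apply/seteqP].
rewrite (_ : mkset _ = set0); last by apply/seteqP; split=> i //= /(_ erefl).
apply/cltNge => /(cle_trans kinf)/cle_card; rewrite (card_le_eqr (card_setT _)).
by move=> /infiniteP.
Qed.

Let box_join (B C : set (boxprod kinf)) (x : boxprod kinf) :
  box_base B -> box_base C -> B x -> C x ->
  exists D, [/\ box_base D, D x & D `<=` B `&` C].
Proof.
move=> [U [oU kU ->]] [V [oV kV ->]] Ux Vx.
exists (box (fun i => U i `&` V i)); split; last 2 first.
- by move=> i; split; [exact: Ux|exact: Vx].
- by move=> y UVy; split=> i; have [] := UVy i.
exists (fun i => U i `&` V i); split=> //; first by move=> i; exact: openI.
apply: clt_subset (clt_setU kinf kU kV) => i /= UV.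
by apply/not_andP => -[Ui Vi]; apply: UV; rewrite Ui Vi setIT.
Qed.

HB.instance Definition _ :=
  isBaseTopological.Build (boxprod kinf) box_cover box_join.

Lemma boxprod_openE (O : set (boxprod kinf)) : open O <->
  exists2 F, F `<=` box_base & O = \bigcup_(B in F) B.
Proof. by split=> [[F sF <-]|[F sF ->]]; exists F. Qed.

End BoxProduct.

(* Main.v *)
(* Upper bound: shrink each member of a cellular family to a basic box.  Two
   disjoint boxes s, t already have disjoint sides at some coordinate j(s,t)
   lying in both supports.  Following the Erdos-Rado tree argument, each box s
   traces a path in a tree of boxes indexed by an initial well-order of kappa: at
   stage x one selects a box u, by a rule depending only on the coordinates j(s, v)
   for the boxes v met earlier, such that u is disjoint from each such v at j(s, v)
   and has a support of the same size as s.  The path meets s before stage kappa: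
   otherwise kappa many stages are distributed over the fewer than kappa
   coordinates of s, and each coordinate receives at most alpha of them, as they
   form a cellular family there.  The box s is thus determined by the size of its
   support and a function from a proper segment of kappa to a set of that size, and
   there are 2^{<kappa} such data.

   Lower bound: two disjoint nonempty open sets in each factor turn pairwise
   incompatible partial 0-1 functions with small domains into disjoint boxes. If
   kappa <= |I|, a subset B of the segment below x is coded by 1^x 0 followed by the
   indicator of B; otherwise kappa = |I|^+ and total functions on I suffice. *)
Require Import Defs.
From mathcomp Require Import all_boot all_classical topology.
From mathcomp Require Import wochoice.
From Stdlib Require Import Inverse_Image.

Set Implicit Arguments.
Unset Strict Implicit.
Unset Printing Implicit Defensive.

Local Open Scope classical_set_scope.
Local Open Scope card_scope.
Local Open Scope cardinal_scope.

(** * Comparison of cardinals, successors and finiteness *)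

Lemma cle_injP (T U : Type) :
  cardinal_of T <= cardinal_of U <-> exists f : T -> U, injective f.
Proof.
split=> [/cle_card/card_le_relP[R [RT Rinj]]|[f finj]].
  have /choice[f fP] : forall x, exists y, R x y.
    by move=> x; have [y _ Rxy] := RT x I; exists y.
  by exists f => x y e; apply: (Rinj _ _ (f x)) => //; rewrite e.
apply/cle_card/(@card_le_rel _ _ _ _ (fun x y => f x = y)).
  by move=> x _; exists (f x).
by move=> x x' y _ _ <- e; apply: finj.
Qed.

Lemma cle_injS (T U : Type) (A : set T) (f : T -> U) :
  {in A &, injective f} -> cardinal_of A <= cardinal_of U.
Proof.
move=> finj; apply/cle_injP; exists (f \o val) => x y e.
by apply: val_inj; apply: finj e; apply: valP.
Qed.

Lemma cle_image (T U : Type) (f : T -> U) (A : set T) :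
  cardinal_of (f @` A) <= cardinal_of A.
Proof. exact/cle_cardS/card_image_le. Qed.

Lemma cle_set (T : Type) (A : set T) : cardinal_of A <= cardinal_of T.
Proof. by apply: (@cle_injS _ _ _ id) => x y _ _. Qed.

Lemma cle_prod (A B C D : Type) :
  cardinal_of A <= cardinal_of B -> cardinal_of C <= cardinal_of D ->
  cardinal_of (A * C) <= cardinal_of (B * D).
Proof.
move=> /cle_injP[f fi] /cle_injP[g gi]; apply/cle_injP.
by exists (fun x => (f x.1, g x.2)) => -[x y] [x' y'] /= [/fi-> /gi->].
Qed.

Lemma cle_lt_trans (b a c : cardinal) : a <= b -> b < c -> a < c.
Proof.
by move=> ab /cltNge bc; apply/cltNge => ca; apply: bc; exact: cle_trans ab.
Qed.

Lemma clt_le_trans (b a c : cardinal) : a < b -> b <= c -> a < c.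
Proof.
by move=> /cltNge ab bc; apply/cltNge => ca; apply: ab; exact: cle_trans ca.
Qed.

Lemma cleNgt (a b : cardinal) : a <= b <-> ~ b < a.
Proof.
split=> [ab /cltNge//|]; rewrite cltNge; exact: contrapT.
Qed.

Lemma csucc_gt (a : cardinal) : a < csucc a.
Proof. exact: (csuccP a).1. Qed.

Lemma csucc_le (a b : cardinal) : csucc a <= b <-> a < b.
Proof.
split; last exact: (csuccP a).2.
exact: clt_le_trans (csucc_gt a).
Qed.

Lemma lt_csucc (a b : cardinal) : b < csucc a <-> b <= a.
Proof. by rewrite cltNge csucc_le cleNgt. Qed.

Lemma aleph0_leP (T : Type) : aleph0 <= cardinal_of T <-> infinite_set [set: T].
Proof. by rewrite cle_card infiniteP. Qed.

Lemma finite_lt (T : Type) (k : cardinal) :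
  aleph0 <= k -> finite_set [set: T] -> cardinal_of T < k.
Proof.
by move=> k0 Tfin; apply: clt_le_trans k0; apply/cltNge => /aleph0_leP; apply.
Qed.

(** * Choice, recursion and well-orders *)

(** The choice is a function of the set, so equal sets give equal choices. This is how two boxes
    with the same code come to trace the same path. The default [t0] is returned only for empty
    [A]. *)
Definition choice_of (T : Type) (t0 : T) (A : set T) : T :=
  if pselect (A !=set0) is left e then sval (cid e) else t0.

Lemma choice_ofP (T : Type) (t0 : T) (A : set T) : A !=set0 -> A (choice_of t0 A).
Proof. by rewrite /choice_of; case: pselect => // e _; exact: svalP. Qed.

Lemma wf_min (T : Type) (lt : T -> T -> Prop) (A : set T) :
  well_founded lt -> A !=set0 -> exists2 x, A x & forall y, lt y x -> ~ A y.
Proof.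
move=> wf [x]; elim/(well_founded_ind wf): x => x IH Ax.
have [[y [yx Ay]]|H] := pselect (exists y, lt y x /\ A y); first exact: IH Ay.
by exists x => // y yx Ay; apply: H; exists y.
Qed.

(* The recursive call sees only the graph of the function below [x]. *)
Lemma wf_recursion (T U : Type) (lt : T -> T -> Prop) (G : T -> set (T * U) -> U) :
  well_founded lt ->
  exists f : T -> U, forall x, f x = G x [set p | lt p.1 x /\ f p.1 = p.2].
Proof.
move=> wf.
pose F (x : T) (rec : forall y, lt y x -> U) : U :=
  G x [set p | exists h : lt p.1 x, rec p.1 h = p.2].
exists (Fix wf (fun=> U) F) => x; rewrite Fix_eq.
  congr G; apply/seteqP; split=> -[y u] /=; first by case.
  by case=> h e; exists h.
move=> {}x g h gh; congr F; apply: functional_extensionality_dep => y.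
exact: functional_extensionality_dep.
Qed.

Definition strict_well_order (T : Type) (lt : T -> T -> Prop) : Prop :=
  well_founded lt /\ forall x y, [\/ lt x y, x = y | lt y x].

Lemma swo_irr (T : Type) (lt : T -> T -> Prop) x :
  strict_well_order lt -> ~ lt x x.
Proof.
move=> [wf _] xx.
have [_ -> /(_ _ xx)] := wf_min wf (ex_intro [set x] x erefl).
exact.
Qed.

(** Either alternative of trichotomy for [x] and [z] would close a cycle of two or three points, a
    set without a minimal element. *)
Lemma swo_trans (T : Type) (lt : T -> T -> Prop) y x z :
  strict_well_order lt -> lt x y -> lt y z -> lt x z.
Proof.
move=> lo xy yz; have [wf tot] := lo.
have [//|xz|zx] := tot x z.
  have [w] := wf_min wf (ex_intro [set x; y] x (or_introl erefl)).
  rewrite -xz in yz.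
  by case=> -> h; exfalso; [apply: (h _ yz); right|apply: (h _ xy); left].
have [w] := wf_min wf (ex_intro [set x; y; z] x (or_introl (or_introl erefl))).
case=> [[]|] -> h; exfalso; [apply: (h _ zx)|apply: (h _ xy)|apply: (h _ yz)].
- by right.
- by left; left.
- by left; right.
Qed.

Lemma exists_swo (T : Type) : exists lt : T -> T -> Prop, strict_well_order lt.
Proof.
have [R Rwo] := @well_ordering_principle {classic T}.
have mino A : (exists x : T, A x) -> exists2 z : T, A z & forall x, A x -> R z x.
  move=> [x Ax]; have [|z [[zA zmin] _]] := Rwo [pred x : {classic T} | `[< A x >]].
    by exists x; exact/asboolP.
  by exists z; [exact/asboolP|move=> y Ay; apply: zmin; exact/asboolP].
have Rtot x y : R x y \/ R y x.
  have [] := mino [set x; y]; first by exists x; left.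
  by move=> z [->|->] H; [left|right]; apply: H; [right|left].
(* Antisymmetry comes from the uniqueness of the minimum of the pair [x], [y]. *)
have Ranti x y : R x y -> R y x -> x = y.
  move=> xy yx; have [|z [_ zu]] := Rwo [pred z : {classic T} | (z == x) || (z == y)].
    by exists x; rewrite inE eqxx.
  have Rr w : R w w by have [] := Rtot w w.
  rewrite -(zu x) ?(zu y) //; split; rewrite ?inE ?eqxx ?orbT //.
    by move=> w; rewrite inE => /orP[]/eqP->.
  by move=> w; rewrite inE => /orP[]/eqP->.
exists (fun x y => R x y /\ x <> y); split.
  move=> x; apply: contrapT => nx.
  have [|z nz zmin] := mino [set x | ~ Acc (fun x y => R x y /\ x <> y) x].
    by exists x.
  apply: nz; constructor=> y [yz ne]; apply: contrapT => ny.
  by apply: ne; apply: Ranti => //; exact: zmin.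
move=> x y; have [->|ne] := pselect (x = y); first by constructor 2.
by have [xy|yx] := Rtot x y; [constructor 1|constructor 3; split=> // /esym].
Qed.

(** A greedy recursion sends each [x] to a point of [carrier b] not yet used. One is left, since the
    points used so far are the image of a segment smaller than [b]. *)
Lemma cle_of_segments (T : Type) (lt : T -> T -> Prop) (b : cardinal) :
  strict_well_order lt -> (forall x, cardinal_of [set y | lt y x] < b) ->
  cardinal_of T <= b.
Proof.
move=> [wf tot] segb.
have [[x0]|T0] := pselect (inhabited T); last first.
  rewrite -(carrierK b); apply/cle_injP.
  by exists (fun x => False_rect _ (T0 (inhabits x))) => x; case: T0.
have free (B : set (carrier b)) : cardinal_of B < b -> exists z, ~ B z.
  move=> /cltNge Bb; apply: contrapT => /forallNP h; apply: Bb.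
  rewrite -[X in X <= _](carrierK b); apply/cle_injP.
  exists (fun z => SigSub (mem_set (contrapT (h z)))) => z z' /(congr1 val).
  exact.
have [b0 _] : exists z : carrier b, ~ set0 z.
  apply: free; apply: cle_lt_trans (segb x0); apply/cle_cardS.
  exact: card_ge0.
have [f fE] := wf_recursion
  (fun x (g : set (T * carrier b)) => choice_of b0 (~` (snd @` g))) wf.
have fN x y : lt y x -> f y <> f x.
  move=> yx; rewrite [f x]fE; set A := snd @` _.
  have : (~` A) (choice_of b0 (~` A)).
    apply: choice_ofP; apply: free; apply: cle_lt_trans (segb x).
    apply: cle_trans (cle_image f [set y | lt y x]); apply/cle_cardS.
    by apply: subset_card_le => _ [[z u] /= [zx <-] <-]; exists z.
  by move=> + e; apply; rewrite -e; exists (y, f y).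
rewrite -(carrierK b); apply/cle_injP; exists f => x y e.
by have [/fN/(_ e)|//|/fN/(_ (esym e))] := tot x y.
Qed.

Definition initial (T : Type) (lt : T -> T -> Prop) : Prop :=
  strict_well_order lt /\ forall x, cardinal_of [set y | lt y x] < cardinal_of T.

(** If some segment of a well-order is as large as [T], inject [T] into the first such segment and
    pull the order back: the new segments inject into shorter, hence smaller, ones. *)
Lemma exists_initial (T : Type) : exists lt : T -> T -> Prop, initial lt.
Proof.
have [lt [wf tot]] := exists_swo T.
have [|H] := pselect ([set x | cardinal_of T <= cardinal_of [set y | lt y x]] !=set0);
  last first.
  exists lt; split=> // x; apply/cltNge => Tx; apply: H; by exists x.
move=> /(wf_min wf)[x /= /cle_injP[g ginj] xmin].
pose f t := val (g t).
have fx t : lt (f t) x by exact: (set_mem (valP (g t))).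
have finj : injective f by move=> s t /val_inj/ginj.
exists (fun s t => lt (f s) (f t)); split.
  split; first exact: wf_inverse_image.
  move=> s t; have [st|/finj->|ts] := tot (f s) (f t);
    by [constructor 1|constructor 2|constructor 3].
move=> t; apply: (@cle_lt_trans (cardinal_of [set y | lt y (f t)])).
  apply/cle_cardS/(@card_le_rel _ _ _ _ (fun s y => f s = y)).
    by move=> s st; exists (f s).
  by move=> s s' y _ _ <- e; apply: finj.
by apply/cltNge; exact: xmin (fx t).
Qed.

(** Take the first segment with at least [b] elements. Its own segments have fewer than [b], so
    [cle_of_segments] bounds it by [b]. *)
Lemma segment_card (T : Type) (lt : T -> T -> Prop) (b : cardinal) :
  strict_well_order lt -> b < cardinal_of T ->
  exists x, cardinal_of [set y | lt y x] = b.
Proof.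
move=> lo; have [wf tot] := lo; move=> bT.
have [|x /= bx xmin] := @wf_min _ _ [set x | b <= cardinal_of [set y | lt y x]] wf.
  apply: contrapT => nseg; move/cltNge: bT; apply.
  apply: (cle_of_segments lo) => x; apply/cltNge => bx; apply: nseg; by exists x.
exists x; apply: cle_anti bx.
pose lt' (y z : [set y | lt y x]) := lt (val y) (val z).
apply: (@cle_of_segments _ lt').
  split; first exact: wf_inverse_image.
  move=> y z; have [yz|/val_inj->|zy] := tot (val y) (val z);
    by [constructor 1|constructor 2|constructor 3].
move=> y; apply: (@cle_lt_trans (cardinal_of [set z | lt z (val y)])).
  apply/cle_cardS/(@card_le_rel _ _ _ _ (fun s z => val s = z)).
    by move=> s st; exists (val s).
  by move=> s s' z _ _ <- /val_inj.
by apply/cltNge; apply: xmin; exact: set_mem (valP y).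
Qed.

(** * Products of infinite cardinals *)

(** Squares are controlled by a hypothesis restricted to cardinals below [k], so that the lemma also
    serves inside the minimal counterexample argument of [infinite_square]. *)
Lemma clt_prod_of (k : cardinal) : aleph0 <= k ->
  (forall T, aleph0 <= cardinal_of T -> cardinal_of T < k ->
    cardinal_of (T * T) <= cardinal_of T) ->
  forall T U, cardinal_of T < k -> cardinal_of U < k -> cardinal_of (T * U) < k.
Proof.
move=> k0 sq T U Tk Uk.
have [V [TV UV Vk]] : exists V, [/\ cardinal_of T <= cardinal_of V,
    cardinal_of U <= cardinal_of V & cardinal_of V < k].
  have [TU|UT] := cle_total (cardinal_of T) (cardinal_of U).
    by exists U; split=> //; exact: cle_refl.
  by exists T; split=> //; exact: cle_refl.
apply: cle_lt_trans (cle_prod TV UV) _.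
have [/sq sqV|/aleph0_leP Vfin] := pselect (aleph0 <= cardinal_of V).
  exact: cle_lt_trans (sqV Vk) Vk.
apply: finite_lt => //; rewrite -setXTT; apply: finite_setX; exact: contrapT.
Qed.

(* Pairs are ordered by their maximum, ties being broken by any well-order: a
   segment then lies in the square of a proper segment of [T]. *)
Lemma infinite_square (T : Type) :
  aleph0 <= cardinal_of T -> cardinal_of (T * T) <= cardinal_of T.
Proof.
move=> T0; apply: contrapT => nT.
pose P b := aleph0 <= b /\ ~ cardinal_of (carrier b * carrier b) <= b.
have PE U : P (cardinal_of U) <->
    aleph0 <= cardinal_of U /\ ~ cardinal_of (U * U) <= cardinal_of U.
  have UU := carrierK (cardinal_of U).
  suff -> : cardinal_of (U * U) =
    cardinal_of (carrier (cardinal_of U) * carrier (cardinal_of U)) by [].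
  by apply: cle_anti; apply: cle_prod; rewrite UU; exact: cle_refl.
have [] := @leastP P _ (proj2 (PE T) (conj T0 nT)).
set k := least P => Pk kmin.
have [k0 nk] := Pk; apply: nk; rewrite -[X in _ <= X]carrierK.
pose W := carrier k; have [lt [lo seg]] := exists_initial W.
rewrite -[cardinal_of W]/(cardinal_of (carrier k)) carrierK in seg.
(* By minimality of [k], squares of infinite cardinals below [k] do not grow. *)
have lt_prod := clt_prod_of k0 (fun U U0 Uk =>
  contrapT (fun nU => (proj1 (cltNge _ _) Uk) (kmin _ (proj2 (PE U) (conj U0 nU))))).
have [wf tot] := lo.
have [lt2 [wf2 tot2]] := exists_swo (W * W).
pose mx (p : W * W) := if pselect (lt p.1 p.2) then p.2 else p.1.
have mx1 p : p.1 = mx p \/ lt p.1 (mx p).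
  by rewrite /mx; case: pselect => //; [right|left].
have mx2 p : p.2 = mx p \/ lt p.2 (mx p).
  rewrite /mx; case: pselect => [|n] /=; first by left.
  by have [//|/esym|] := tot p.1 p.2; [left|right].
pose ltm p q := lt (mx p) (mx q) \/ (mx p = mx q /\ lt2 p q).
rewrite carrierK; apply: (@cle_of_segments _ ltm).
  split.
    move=> p; have [m] := ex_intro (fun m => mx p = m) _ erefl.
    elim/(well_founded_ind wf): m p => m IHm p.
    elim/(well_founded_ind wf2): p => p IHp pm.
    constructor=> q [|[e qp]]; first by rewrite pm => qm; exact: IHm qm _ erefl.
    by apply: IHp => //; rewrite e.
  move=> p q; have [pq|e|qp] := tot (mx p) (mx q).
  - by constructor 1; left.
  - have [pq|->|qp] := tot2 p q; first by constructor 1; right.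
      by constructor 2.
    by constructor 3; right.
  - by constructor 3; left.
(* The point [mx p] is adjoined for the pairs whose maximum ties with that of [p]. *)
move=> p; pose C := [set x | lt x (mx p)] `|` [set mx p].
have Ck : cardinal_of C < k.
  apply: clt_setU => //; apply: finite_lt => //.
  by rewrite (eq_finite_set (card_setT _)); exact: finite_set1.
apply: cle_lt_trans (lt_prod _ _ Ck Ck); apply/cle_card.
rewrite (card_le_eql (card_setT _)).
apply: (@card_le_rel _ _ _ _ (fun q (r : C * C) => q = (val r.1, val r.2))).
  move=> q qp; have mq : C (mx q) by case: qp => [qp|[e _]]; [left|right].
  have Cle x : x = mx q \/ lt x (mx q) -> C x.
    move=> [e|xq]; first by rewrite e.
    left; case: mq => [mq|<- //]; exact: swo_trans xq mq.
  by exists (SigSub (mem_set (Cle _ (mx1 q))), SigSub (mem_set (Cle _ (mx2 q)))) => //=;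
    rewrite -surjective_pairing.
by move=> q q' r _ _ -> ->.
Qed.

Lemma clt_prod (T U : Type) (k : cardinal) : aleph0 <= k ->
  cardinal_of T < k -> cardinal_of U < k -> cardinal_of (T * U) < k.
Proof. by move=> k0; apply: clt_prod_of => // V V0 _; exact: infinite_square. Qed.

Lemma cle_prod_infinite (T U V : Type) : aleph0 <= cardinal_of V ->
  cardinal_of T <= cardinal_of V -> cardinal_of U <= cardinal_of V ->
  cardinal_of (T * U) <= cardinal_of V.
Proof.
move=> V0 TV UV; apply: cle_trans (infinite_square V0); exact: cle_prod.
Qed.

(** * Powers and the sum of the powers below [k] *)

Lemma cpow2E (T : Type) : cpow2 (cardinal_of T) = cardinal_of (set T).
Proof.
suff mono (A B : Type) : cardinal_of A <= cardinal_of B ->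
    cardinal_of (set A) <= cardinal_of (set B).
  by apply: cle_anti; apply: mono; rewrite carrierK; exact: cle_refl.
move=> /cle_injP[f finj]; apply/cle_injP; exists (image^~ f) => C D /= e.
by apply/seteqP; split=> x; rewrite -!(image_inj finj) e.
Qed.

Lemma cle_cpow2 (a b : cardinal) : a <= b -> cpow2 a <= cpow2 b.
Proof.
rewrite -(carrierK a) -(carrierK b) !cpow2E => /cle_injP[f finj].
apply/cle_injP; exists (image^~ f) => C D /= e.
by apply/seteqP; split=> x; rewrite -!(image_inj finj) e.
Qed.

Lemma cle_fun (T U : Type) (A : set T) (B : set U) (u0 : U) :
  cardinal_of A <= cardinal_of B -> exists f : T -> U,
  (forall x, A x -> B (f x)) /\ (forall x y, A x -> A y -> f x = f y -> x = y).
Proof.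
move=> /cle_cardS/card_le_relP[R [RB Rinj]].
have /choice[f fP] x : exists y, A x -> B y /\ R x y.
  have [Ax|nAx] := pselect (A x); last by exists u0.
  by have [y By Rxy] := RB _ Ax; exists y.
exists f; split=> [x /fP[]//|x y Ax Ay e]; apply: (Rinj _ _ (f x)) => //.
  by have [] := fP _ Ax.
by rewrite e; have [] := fP _ Ay.
Qed.

Lemma cle_powerset (T : Type) (C : set T) :
  cardinal_of [set B : set T | B `<=` C] <= cpow2 (cardinal_of C).
Proof.
rewrite cpow2E; apply: (@cle_injS _ _ _ (fun B => [set x : C | B (val x)])).
move=> B D /set_mem BC /set_mem DC e.
have eP x (Cx : C x) : B x = D x := congr1 (@^~ (SigSub (mem_set Cx))) e.
by apply/seteqP; split=> x Hx; [rewrite -eP//; exact: BC|rewrite eP//; exact: DC].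
Qed.

Lemma cle_sigma (T U : Type) (A : set (T * U)) (a : cardinal) :
  (forall x, cardinal_of [set u | A (x, u)] <= a) ->
  cardinal_of A <= cardinal_of (T * carrier a).
Proof.
move=> Aa; apply/cle_card; rewrite (card_le_eql (card_setT _)).
have /choice[R RP] x : exists R : U -> carrier a -> Prop,
    (forall u, A (x, u) -> exists y, R u y) /\
    (forall u v y, A (x, u) -> A (x, v) -> R u y -> R v y -> u = v).
  have := Aa x; rewrite -[X in _ <= X -> _]carrierK => /cle_card.
  rewrite (card_le_eql (card_setT _)) => /card_le_relP[R [RT Rinj]].
  by exists R; split=> // u /RT[y _ uy]; exists y.
apply: (@card_le_rel _ _ _ _ (fun p q => p.1 = q.1 /\ R p.1 p.2 q.2)).
  by move=> [x u] /((RP x).1)[y uy]; exists (x, y).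
move=> [x u] [x' v] [z y] Au Av /= [xz Ru] [x'z Rv].
rewrite xz in Au Ru; rewrite x'z in Av Rv; rewrite xz x'z.
by rewrite ((RP z).2 u v y).
Qed.

Lemma cpow2_le_cpow2_lt (k b : cardinal) : b < k -> cpow2 b <= cpow2_lt k.
Proof.
move=> /below_val_surj[l <-]; rewrite -[X in X <= _]carrierK.
apply/cle_injP; exists (Tagged (fun l => carrier (cpow2 (below_val l)))) => A B.
exact: (@existT_inj2 {classic below k}).
Qed.

(** Were [cpow2_lt k] below [k], its own power would be a summand of it, against Cantor. *)
Lemma cle_cpow2_lt (k : cardinal) : k <= cpow2_lt k.
Proof.
by apply/cleNgt => /cpow2_le_cpow2_lt; apply/cltNge; exact: clt_cpow2.
Qed.

Section InitialOrder.
Variables (k : cardinal) (lt : carrier k -> carrier k -> Prop).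
Hypothesis lt_init : initial lt.

Lemma segment_lt x : cardinal_of [set y | lt y x] < k.
Proof. by have := lt_init.2 x; rewrite carrierK. Qed.

(** Each [l < k] is the size of a segment, whose subsets receive the summand of [l]. The endpoint
    determines [l], so different summands do not collide. *)
Lemma cpow2_lt_le_segments :
  cpow2_lt k <= cardinal_of [set p : carrier k * set (carrier k) |
    p.2 `<=` [set y | lt y p.1]].
Proof.
have code (l : below k) :
    exists p : carrier k * (carrier (cpow2 (below_val l)) -> set (carrier k)),
    [/\ cardinal_of [set y | lt y p.1] = below_val l, injective p.2
      & forall A, p.2 A `<=` [set y | lt y p.1]].
  have [lk _] := below_valP l.
  have [|x xl] := @segment_card _ lt (below_val l) lt_init.1; first by rewrite carrierK.
  have : cpow2 (below_val l) <= cardinal_of (set [set y | lt y x]).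
    by rewrite -cpow2E xl; exact: cle_refl.
  rewrite -[X in X <= _]carrierK => /cle_injP[f finj].
  exists (x, fun A => val @` f A); split=> //= [A B /= e|A _ [y _ <-]].
    by apply: finj; apply/seteqP; split=> y; rewrite -!(image_inj val_inj) e.
  exact: set_mem (valP y).
pose c l := sval (cid (code l)); have cP l := svalP (cid (code l)).
rewrite -!/(c _) in cP.
apply/cle_card; rewrite (card_le_eqr (card_setT _)).
apply: (@card_le_rel _ _ _ _ (fun s p => p = ((c (tag s)).1, (c (tag s)).2 (tagged s)))).
  move=> s _; eexists; last reflexivity.
  by have [_ _] := cP (tag s); apply.
move=> [l A] [m B] _ _ _ /= -> [].
have [lE linj _] := cP l; have [mE _ _] := cP m => e.
have lm : l = m by apply: below_val_inj; rewrite -lE -mE e.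
by rewrite lm in A linj {lE mE e} *; move=> /linj ->.
Qed.

End InitialOrder.

(** * The tree argument for the upper bound *)

Section DisjointnessGraph.
Variables (k a : cardinal) (S I : Type).
Variables (supp : S -> set I) (dis : S -> S -> I -> Prop).
Hypotheses (k_inf : aleph0 <= k) (ak : a < k).
Hypothesis supp_lt : forall s, cardinal_of (supp s) < k.
Hypothesis disP : forall s t, s <> t -> exists i, [/\ supp s i, supp t i & dis s t i].
Hypothesis dis_irr : forall s i, ~ dis s s i.
Hypothesis dis_sym : forall s t i, dis s t i -> dis t s i.
Hypothesis dis_clique : forall i (G : set S),
  (forall s t, G s -> G t -> s <> t -> dis s t i) -> cardinal_of G <= a.

(** Here [S] stands for a cellular family of boxes, [supp s] for the support of a box, and
    [dis s t i] for disjointness of the sides at [i]. Then [dis_clique] is the Souslin bound on the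
    factors. *)
Lemma disjointness_graph_le : cardinal_of S <= cpow2_lt k.
Proof.
(* Without coordinates, [disP] leaves at most one element in [S], and any constant map is
   injective. *)
have [[i0]|I0] := pselect (inhabited I); last first.
  have : aleph0 <= cpow2_lt k by apply: cle_trans k_inf _; exact: cle_cpow2_lt.
  rewrite -[X in _ <= X -> _]carrierK => /cle_injP[f _].
  rewrite -[X in _ <= X]carrierK; apply/cle_injP; exists (fun=> f 0%N) => s t _.
  by apply: contrapT => /disP[i _]; apply: I0.
have [[s0]|S0] := pselect (inhabited S); last first.
  rewrite -[X in _ <= X]carrierK; apply/cle_injP.
  by exists (fun s => False_rect _ (S0 (inhabits s))) => s; case: S0.
have [lt lt_init] := exists_initial (carrier k).
have [lo _] := lt_init; have [wf tot] := lo.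
(* The first component marks a segment of the size of the support; the second injects the support
   into that segment. *)
have /choice[ze zeP] s : exists ze : carrier k * (I -> carrier k),
    (forall i, supp s i -> lt (ze.2 i) ze.1) /\
    (forall i j, supp s i -> supp s j -> ze.2 i = ze.2 j -> i = j).
  have [|x xs] := @segment_card _ lt (cardinal_of (supp s)) lo.
    by rewrite carrierK.
  have [|e eP] := @cle_fun _ _ (supp s) [set y | lt y x] x.
    by rewrite xs; exact: cle_refl.
  by exists (x, e).
pose z s := (ze s).1; pose e s := (ze s).2.
have /choice[j jP] : forall st : S * S, exists i, st.1 <> st.2 ->
    [/\ supp st.1 i, supp st.2 i & dis st.1 st.2 i].
  move=> [s t] /=; have [->|/disP[i iP]] := pselect (s = t); first by exists i0.
  by exists i.
have /choice[p pE] s := wf_recursion (fun _ (g : set (carrier k * S)) =>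
  choice_of s0 [set u | z u = z s /\ forall q, g q -> dis u q.2 (j (s, q.2))]) wf.
(* The candidates at stage [x] depend on [s] only through [z s], the boxes met earlier and the
   coordinates [j (s, _)]. *)
pose D s x := [set u | z u = z s /\ forall y, lt y x -> dis u (p s y) (j (s, p s y))].
have {}pE s x : p s x = choice_of s0 (D s x).
  rewrite pE; congr choice_of; apply/seteqP; split=> u /= [zu du]; split=> //.
    by move=> y yx; exact: (du (y, p s y)).
  by move=> [y t] /= [yx <-]; exact: du.
(* Until the path has met [s], the box [s] is itself a candidate, so the choice does not fall back
   on [s0]. *)
have Ds s x : (forall y, lt y x -> p s y <> s) -> D s x s.
  by move=> ps; split=> // y /ps/nesym/(jP (s, _))[].
have pD s x : (forall y, lt y x -> p s y <> s) -> D s x (p s x).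
  by move=> ps; rewrite pE; apply: choice_ofP; exists s; exact: Ds.
have stop s : exists x, p s x = s.
  apply: contrapT => /forallNP ps.
  have {}pD x : D s x (p s x) by apply: pD.
  have jsupp x : supp s (j (s, p s x)) by have [] := jP (s, p s x) (nesym (ps x)).
  have pdis x y : lt y x -> dis (p s x) (p s y) (j (s, p s y)).
    by move=> yx; apply: (pD x).2.
  have pinj x y : p s x = p s y -> x = y.
    move=> exy; have [/pdis|//|/pdis] := tot x y; rewrite exy => /dis_irr; exact.
  (* The boxes on the path are sorted by coordinate. Of two in one fibre the later was chosen
     disjoint from the earlier there, so the fibre is a clique. *)
  pose A := [set q : supp s * S | j (s, q.2) = val q.1 /\ exists x, p s x = q.2].
  have Aa i : cardinal_of [set t | A (i, t)] <= a.
    apply: (@dis_clique (val i)) => u v [/= ju [x xu]] [/= jv [y yv]].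
    rewrite -{}xu in ju *; rewrite -{}yv in jv * => ne.
    have [/pdis|xy|/pdis] := tot x y.
    - by rewrite ju; exact: dis_sym.
    - by case: ne; rewrite xy.
    - by rewrite jv.
  have : k <= cardinal_of A.
    rewrite -{1}(carrierK k); apply/cle_card; rewrite (card_le_eqr (card_setT _)).
    apply: (@card_le_rel _ _ _ _ (fun x q => q.2 = p s x)) => [x _|x y q _ _ ->].
      exists (SigSub (mem_set (jsupp x)), p s x) => //.
      by split=> //; exists x.
    exact: pinj.
  apply/cltNge; apply: cle_lt_trans (cle_sigma Aa) _; apply: clt_prod => //.
  by rewrite carrierK.
have /choice[xi xiP] s : exists x, p s x = s /\ forall y, lt y x -> p s y <> s.
  have [x psx] := stop s.
  by have [y] := wf_min wf (ex_intro [set x | p s x = s] x psx); exists y.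
(* The coordinate is recorded through [e] of the box met, not through [e s]: where two paths agree,
   a single injection then decodes both. *)
pose code s : set (carrier k * carrier k) :=
  [set q | lt q.1 (xi s) /\ q.2 = e (p s q.1) (j (s, p s q.1))].
pose C := [set q : (carrier k * carrier k) * set (carrier k * carrier k) |
  q.2 `<=` [set r | lt r.1 q.1.1 /\ lt r.2 q.1.2]].
have zp s x : lt x (xi s) -> z (p s x) = z s.
  move=> xs; have [] // : D s x (p s x); apply: pD => y yx.
  by apply: (xiP s).2; exact: swo_trans yx xs.
have jp s x : lt x (xi s) -> supp (p s x) (j (s, p s x)).
  by move=> /((xiP s).2) ne; have [] := jP (s, p s x) (nesym ne).
apply: (@cle_trans (cardinal_of C)).
  apply/cle_card; rewrite (card_le_eqr (card_setT _)).
  apply: (@card_le_rel _ _ _ _ (fun s q => q = (xi s, z s, code s))).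
    move=> s _; eexists; last reflexivity.
    move=> q [qs qE]; split=> //; rewrite qE -(zp s q.1) //.
    by apply: (zeP _).1; exact: jp.
  move=> s t _ _ _ -> [ext ezt ecode].
  (* Equal codes force equal coordinates at all earlier stages, hence equal candidate sets. At the
     common stage [xi s] the two paths stand at [s] and at [t]. *)
  have pst x : ~ lt (xi s) x -> p s x = p t x.
    elim/(well_founded_ind wf): x => x IH nx.
    have below y : lt y x ->
        [/\ lt y (xi s), p s y = p t y & j (s, p s y) = j (t, p t y)].
      move=> yx; have ys : lt y (xi s).
        have [//|ye|sy] := tot y (xi s); first by case: nx; rewrite -ye.
        by case: nx; exact: swo_trans sy yx.
      have yt : lt y (xi t) by rewrite -ext.
      have py : p s y = p t y.
        by apply: IH => // sy; apply: (swo_irr lo (x := y)); exact: swo_trans ys sy.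
      split=> //; have : code s (y, e (p s y) (j (s, p s y))) by [].
      rewrite ecode => -[_ /=]; rewrite -py; apply: (zeP _).2; first exact: jp.
      by rewrite py; exact: jp.
    rewrite !pE; congr choice_of; rewrite /D ezt.
    apply/seteqP; split=> u [zu du]; split=> // y yx.
      by have [_ <- <-] := below _ yx; exact: du.
    by have [_ -> ->] := below _ yx; exact: du.
  by rewrite -(xiP s).1 -(xiP t).1 -ext; apply: pst; exact: swo_irr.
have kN : cardinal_of (carrier k) <= cardinal_of (carrier (cpow2_lt k)).
  by rewrite !carrierK; exact: cle_cpow2_lt.
have N0 : aleph0 <= cardinal_of (carrier (cpow2_lt k)).
  by apply: cle_trans kN; rewrite carrierK.
(* For fixed endpoints, a code is a subset of a product of two segments, which has size below
   [k]. *)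
apply: (@cle_trans (cardinal_of (carrier k * carrier k * carrier (cpow2_lt k)))).
  apply: cle_sigma => -[x y].
  apply: cle_trans (cle_powerset [set r | lt r.1 x /\ lt r.2 y]) _.
  apply: cpow2_le_cpow2_lt.
  apply: (@cle_lt_trans (cardinal_of ([set w | lt w x] * [set w | lt w y]))); last first.
    by apply: clt_prod => //; exact: segment_lt.
  apply/cle_card; rewrite (card_le_eql (card_setT _)).
  apply: (@card_le_rel _ _ _ _ (fun r (q : [set w | lt w x] * [set w | lt w y]) =>
    r = (val q.1, val q.2))) => [r [r1 r2]|_ _ q _ _ -> -> //].
  exists (SigSub (@mem_set _ [set w | lt w x] _ r1),
    SigSub (@mem_set _ [set w | lt w y] _ r2)) => //=.
  exact: surjective_pairing.
rewrite -[X in _ <= X]carrierK.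
apply: (cle_prod_infinite N0 _ (cle_refl _)); exact: cle_prod_infinite.
Qed.

End DisjointnessGraph.

(** * Cardinal estimates for the case of an index set smaller than kappa *)

(** Every [l < k] is at most the size of [T]. A subset of [T] of size [l] tags the summand, which
    embeds in [set T]; the square of [set T] is then absorbed. *)
Lemma cpow2_lt_le_powerset (k : cardinal) (T : Type) :
  aleph0 <= cardinal_of T -> k <= csucc (cardinal_of T) ->
  cpow2_lt k <= cardinal_of (set T).
Proof.
move=> T0 kT; have below_le (l : below k) : below_val l <= cardinal_of T.
  by apply/lt_csucc; apply: clt_le_trans kT; have [] := below_valP l.
have code (l : below k) : exists p : set T * (carrier (cpow2 (below_val l)) -> set T),
    cardinal_of p.1 = below_val l /\ injective p.2.
  have := below_le l; rewrite -[X in X <= _]carrierK => /cle_injP[f finj].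
  have : cpow2 (below_val l) <= cardinal_of (set T).
    by rewrite -cpow2E; exact: cle_cpow2.
  rewrite -[X in X <= _]carrierK => /cle_injP[g ginj].
  exists (range f, g); split=> //=; rewrite -[RHS]carrierK; apply/Defs.cardE.
  by rewrite (card_eql (card_setT _)); apply: inj_card_eq => x y _ _ /finj.
pose c l := sval (cid (code l)); have cP l := svalP (cid (code l)).
rewrite -!/(c _) in cP.
have sT0 : aleph0 <= cardinal_of (set T).
  by apply: cle_trans T0 _; rewrite -cpow2E; exact: (clt_cpow2 _).1.
apply: cle_trans (cle_prod_infinite sT0 (cle_refl _) (cle_refl _)).
apply/cle_injP; exists (fun s => ((c (tag s)).1, (c (tag s)).2 (tagged s))).
move=> [l A] [m B] /= [].
have [lE linj] := cP l; have [mE _] := cP m => e.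
have lm : l = m by apply: below_val_inj; rewrite -lE -mE e.
by rewrite lm in A linj {lE mE e} *; move=> /linj ->.
Qed.

Lemma csucc_finite (T : Type) : finite_set [set: T] -> csucc (cardinal_of T) < aleph0.
Proof.
move=> /finite_setP[n Tn]; have -> : cardinal_of T = cnat n.
  by apply/Defs.cardE; rewrite -(card_eqr card_II).
apply: (@cle_lt_trans (cnat n.+1)).
  apply/csucc_le/cltNge => /cle_card.
  by rewrite -(card_le_eql card_II) -(card_le_eqr card_II) card_le_II ltnn.
by apply: finite_lt (cle_refl _) _; exact: finite_finset.
Qed.

(** * Souslin numbers *)

(** Subfamilies of a cellular family are cellular, so a large [F] would contain one of size exactly
    [souslin X]. *)
Lemma souslin_gt (X : topologicalType) (F : set (set X)) :
  cellular F -> cardinal_of F < souslin X.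
Proof.
move=> [Fo Ft]; apply/cltNge; rewrite -[X in X <= _]carrierK => /cle_injP[f finj].
apply: (souslinP X).1; exists (range (val \o f)); split.
  split=> [_ [x _ <-]|]; first by apply: Fo; exact: set_valP.
  by apply: sub_trivIset Ft => _ [x _ <-]; exact: set_valP.
rewrite -[RHS]carrierK; apply/Defs.cardE; rewrite (card_eql (card_setT _)).
by apply: inj_card_eq => x y _ _ /val_inj/finj.
Qed.

Lemma lt_souslin (X : topologicalType) (a : cardinal) :
  a < souslin X -> exists F : set (set X), cellular F /\ cardinal_of F = a.
Proof. by move=> /cltNge aX; apply: contrapT => nF; apply: aX; exact: (souslinP X).2. Qed.

Lemma souslin_ge3 (X : topologicalType) : cnat 3 <= souslin X ->
  exists U : bool -> set X,
    (forall b, open (U b) /\ U b !=set0) /\ U true `&` U false = set0.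
Proof.
move=> X3; have /lt_souslin[F [[Fo Ft] F2]] : cnat 2 < souslin X.
  apply: clt_le_trans X3; apply/cltNge => /cle_card.
  by rewrite -(card_le_eql card_II) -(card_le_eqr card_II) card_le_II.
have : cardinal_of bool <= cardinal_of F.
  rewrite F2; apply/cle_injP; exists (fun b : bool => if b then ord0 else ord_max).
  by case=> -[].
move=> /cle_injP[f finj]; exists (val \o f); split=> [b|].
  by apply: Fo; exact: set_valP.
apply/seteqP; split=> // x [ft ff].
suff /finj : f true = f false by [].
apply: val_inj; apply: Ft; [exact: set_valP|exact: set_valP|by exists x].
Qed.

(** * Cellular families in box products *)

Section BoxProductCellular.
Variables (k : cardinal) (k_inf : aleph0 <= k) (I : Type) (X : I -> topologicalType).
Local Notation boxk := (@box k k_inf I X).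

Lemma box_open (U : forall i, set (X i)) : (forall i, open (U i)) ->
  cardinal_of [set i | U i <> setT] < k -> open (boxk U).
Proof.
move=> oU kU; apply/boxprod_openE; exists [set boxk U]; last by rewrite bigcup_set1.
by move=> _ ->; exists U.
Qed.

(** A partial 0-1 function on [K], moved into [I] by [f], selects one of two disjoint open sets at
    each coordinate of its domain and the whole factor elsewhere. A conflict of two codes makes
    their boxes disjoint. *)
Lemma box_cellular (S K : Type) (f : K -> I) (code : S -> K -> option bool) :
  injective f -> (forall i, cnat 3 <= souslin (X i)) ->
  (forall s, cardinal_of [set q | code s q <> None] < k) ->
  (forall s t, s <> t -> exists q b, code s q = Some b /\ code t q = Some (~~ b)) ->
  cardinal_of S < souslin (boxprod X k_inf).
Proof.
move=> finj X3 supp_lt codeP.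
have Xi i := cid (souslin_ge3 (X3 i)).
pose U i := sval (Xi i); have UP i : _ /\ _ := svalP (Xi i).
pose code' s i := if pselect (exists q, f q = i) is left e then code s (sval (cid e))
  else None.
have code'E s q : code' s (f q) = code s q.
  rewrite /code'; case: pselect => [e|[]]; last by exists q.
  by rewrite (finj _ _ (svalP (cid e))).
pose B s i := if code' s i is Some b then U i b else setT.
have BP s i : open (B s i) /\ B s i !=set0.
  rewrite /B; case: (code' s i) => [b|]; first exact: (UP i).1.
  split; first exact: openT.
  by have [x _] := ((UP i).1 true).2; exists x.
have Bnon s : boxk (B s) !=set0.
  by exists (fun i => sval (cid (BP s i).2)) => i; exact: svalP (cid (BP s i).2).
have Bdis s t : boxk (B s) `&` boxk (B t) !=set0 -> s = t.
  move=> [x [sx tx]]; apply: contrapT => /codeP[q [b [sq tq]]].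
  have := sx (f q); have := tx (f q); rewrite /B !code'E sq tq.
  have Udis y : ~ (U (f q) true y /\ U (f q) false y).
    by move=> Uy; have : set0 y by rewrite -(UP (f q)).2.
  by case: b {sq tq} => /= Ut Us; apply: (Udis (x (f q))).
apply: (@cle_lt_trans (cardinal_of (range (fun s => boxk (B s))))); last first.
  apply: souslin_gt; split.
    move=> _ [s _ <-]; split=> //; apply: box_open => [i|]; first exact: (BP s i).1.
    apply: cle_lt_trans (supp_lt s); apply: cle_trans (cle_image f _).
    apply/cle_cardS/subset_card_le => i /=.
    have [[q <-]|nq] := pselect (exists q, f q = i); rewrite /B.
      by rewrite code'E => e; exists q => // qN; apply: e; rewrite qN.
    by rewrite /code'; case: pselect.
  by move=> _ _ [s _ <-] [t _ <-] /Bdis ->.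
apply/cle_card; rewrite (card_le_eqr (card_setT _)).
apply: (@card_le_rel _ _ _ _ (fun s A => A = boxk (B s))) => [s _|].
  by exists (boxk (B s)) => //; exists s.
by move=> s t _ _ _ -> e; apply: Bdis; rewrite -e setIid.
Qed.

Lemma cellular_le (a : cardinal) (F : set (set (boxprod X k_inf))) :
  a < k -> (forall i, souslin (X i) <= csucc a) ->
  cellular F -> cardinal_of F <= cpow2_lt k.
Proof.
move=> ak Xa [Fo Ft].
have base A : F A -> exists U : forall i, set (X i), [/\ forall i, open (U i),
    forall i, U i !=set0, cardinal_of [set i | U i <> setT] < k & boxk U `<=` A].
  move=> /Fo[/boxprod_openE[G Gb ->] [x [B GB]]].
  have [U [oU kU BU]] := Gb _ GB; rewrite BU => Ux.
  exists U; split=> //; first by move=> i; exists (x i).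
  by rewrite -BU => y By; exists B.
pose U s := sval (cid (base _ (set_valP s))).
have UP s : [/\ _, _, _ & _] := svalP (cid (base _ (set_valP s))).
have Us0 s i : U s i !=set0 by have [_ + _ _] := UP s; exact.
apply: (@disjointness_graph_le k a F I (fun s => [set i | U s i <> setT])
  (fun s t i => U s i `&` U t i = set0)) => //.
- by move=> s; have [] := UP s.
- move=> s t st; apply: contrapT => /forallNP nst; apply: st.
  have [_ _ _ Us] := UP s; have [_ _ _ Ut] := UP t.
  (* Sides that meet at every coordinate would give a common point of the boxes. Off a support the
     side is the whole factor, so nonemptiness of the other side suffices. *)
  have meet i : exists x, U s i x /\ U t i x.
    have [e|Usi] := pselect (U s i = setT).
      by have [x tx] := Us0 t i; exists x; split=> //; rewrite e.
    have [e|Uti] := pselect (U t i = setT).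
      by have [x sx] := Us0 s i; exists x; split=> //; rewrite e.
    have /eqP/set0P[x [sx tx]] : U s i `&` U t i <> set0.
      by move=> e; apply: (nst i).
    by exists x.
  pose x : boxprod X k_inf := fun i => sval (cid (meet i)).
  apply: val_inj; apply: Ft; [exact: set_valP|exact: set_valP|exists x].
  by split; [apply: Us|apply: Ut] => i; have [] := svalP (cid (meet i)).
- by move=> s i; rewrite setIid; apply/eqP/set0P; exact: Us0.
- by move=> s t i; rewrite setIC.
(* The sides at [i] form a cellular family in [X i]. Being nonempty and disjoint, they are distinct
   for distinct indices, so [H] is as large as [G]. *)
move=> i G Gdis; pose H := (fun s => U s i) @` G.
have UI s t : G s -> G t -> U s i `&` U t i !=set0 -> s = t.
  by move=> Gs Gt; apply: contraPP => /(Gdis _ _ Gs Gt)-> [].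
apply: (@cle_trans (cardinal_of H)).
  apply/cle_cardS/(@card_le_rel _ _ _ _ (fun s A => A = U s i)) => [s Gs|].
    by exists (U s i) => //; exists s.
  by move=> s t A Gs Gt -> e; apply: UI => //; rewrite -e setIid.
apply/lt_csucc; apply: clt_le_trans (Xa i); apply: souslin_gt; split.
  by move=> _ [s _ <-]; split=> //; have [+ _ _ _] := UP s; exact.
by move=> _ _ [s Gs <-] [t Gt <-] /UI ->.
Qed.

End BoxProductCellular.

(** * The two inequalities *)

Theorem corollary5p36 (alpha kappa : cardinal) (I : Type)
    (X : I -> topologicalType)
    (alpha_ge3 : cnat 3 <= alpha) (kappa_inf : aleph0 <= kappa)
    (card_I : kappa <= csucc (cardinal_of I))
    (souslin_X : forall i : I,
       cnat 3 <= souslin (X i) /\ souslin (X i) <= csucc alpha)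
    (alpha_kappa : csucc alpha <= kappa) :
  souslin (boxprod X kappa_inf) = csucc (cpow2_lt kappa).
Proof.
have X3 i := (souslin_X i).1; have Xa i := (souslin_X i).2.
apply: cle_anti.
  have ak : alpha < kappa by exact/csucc_le.
  apply: (souslinP _).2 => -[F [/(cellular_le ak Xa) + e]].
  by rewrite e => /cleNgt; apply; exact: csucc_gt.
apply/csucc_le; have [kI|Ik] := pselect (kappa <= cardinal_of I); last first.
  have {}Ik : cardinal_of I < kappa by exact/cltNge.
  have I0 : aleph0 <= cardinal_of I.
    apply/aleph0_leP => /csucc_finite/cltNge; apply; exact: cle_trans card_I.
  apply: cle_lt_trans (cpow2_lt_le_powerset I0 card_I) _.
  (* With fewer than [kappa] coordinates, indicator functions on all of [I] are admissible codes. *)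
  apply: (@box_cellular _ kappa_inf _ X _ _ id (fun A i => Some `[< A i >])) => //.
    by move=> A; apply: cle_lt_trans (cle_set _) Ik.
  move=> A B AB; apply: contrapT => nAB; apply: AB; apply/seteqP.
  suff AB i : A i = B i by split=> i; rewrite AB.
  apply: contrapT => ne; apply: nAB; exists i, `[< A i >]; split=> //.
  congr Some; apply/idP/idP.
    by move=> /asboolP Bi; apply/asboolPn => Ai; apply: ne; exact/propext.
  move=> /asboolPn nAi; apply/asboolP; apply: contrapT => nBi; apply: ne.
  by apply/propext; split.
have [lt lt_init] := exists_initial (carrier kappa).
have [lo _] := lt_init; have [wf tot] := lo.
apply: cle_lt_trans (cpow2_lt_le_segments lt_init) _.
(* Two copies of [kappa] are placed in [I]: the [true] copy holds the prefix of ones and its closing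
   zero, the [false] copy the indicator of the subset. *)
have [f finj] : exists f : carrier kappa * bool -> I, injective f.
  apply/cle_injP; apply: cle_trans kI; rewrite -[X in _ <= X]carrierK.
  by apply/cle_card/infinite_double/aleph0_leP; rewrite carrierK.
pose code (p : carrier kappa * set (carrier kappa)) (q : carrier kappa * bool) :=
  if `[< lt q.1 p.1 >] then Some (q.2 || `[< p.2 q.1 >])
  else if q.2 && `[< q.1 = p.1 >] then Some false else None.
apply: (@box_cellular _ kappa_inf _ X _ _ f (fun s => code (val s))) => //.
  move=> s; set x := (val s).1; pose C := [set y | lt y x] `|` [set x].
  have Ck : cardinal_of C < kappa.
    apply: clt_setU => //; first exact: segment_lt.
    by apply: finite_lt => //; rewrite (eq_finite_set (card_setT _)); exact: finite_set1.
  have k2 : cardinal_of bool < kappa by apply: finite_lt => //; exact: finite_finset.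
  apply: cle_lt_trans (clt_prod kappa_inf Ck k2); apply/cle_card.
  rewrite (card_le_eql (card_setT _)).
  apply: (@card_le_rel _ _ _ _ (fun q (r : C * bool) => q = (val r.1, r.2))).
    move=> q qn; have Cq : C q.1.
      apply: contrapT => nC; apply: qn; rewrite /code.
      case: asboolP => [ltq|_]; first by case: nC; left.
      by case: asboolP => [eq|_]; [case: nC; right|rewrite andbF].
    by exists (SigSub (mem_set Cq), q.2) => //=; exact: surjective_pairing.
  by move=> q q' r _ _ -> ->.
(* The zero closing the shorter prefix conflicts with a one of the longer. *)
have prefix p q : lt p.1 q.1 ->
    code p (p.1, true) = Some false /\ code q (p.1, true) = Some true.
  move=> pq; rewrite /code /=; split; last by case: asboolP.
  by case: asboolP => [/(swo_irr lo)//|_]; case: asboolP.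
move=> s t st; have [lst|est|lts] := tot (val s).1 (val t).1.
- by have [] := prefix _ _ lst; exists ((val s).1, true), false.
(* With equal endpoints both subsets lie in the same segment, so they differ at a point where both
   codes are defined. *)
- have [y ly ne] : exists2 y, lt y (val s).1 & (val s).2 y <> (val t).2 y.
    apply: contrapT => nst; apply: st; apply: val_inj.
    rewrite [val s]surjective_pairing [val t]surjective_pairing est; congr pair.
    have sub (u : [set p : carrier kappa * set (carrier kappa) |
      p.2 `<=` [set y | lt y p.1]]) : (val u).2 `<=` [set y | lt y (val u).1].
      exact: set_valP u.
    apply/funext => y; apply/propext; split=> uy; apply: contrapT => vy;
      apply: nst; exists y.
    + exact: (sub s).
    + by move=> e; apply: vy; rewrite -e.
    + by rewrite est; exact: (sub t).
    + by move=> e; apply: vy; rewrite e.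
  exists (y, false), `[< (val s).2 y >]; rewrite /code /= -est.
  case: asboolP => // _; split=> //; congr Some; apply/idP/idP.
    by move=> /asboolP ty; apply/asboolPn => sy; apply: ne; exact/propext.
  move=> /asboolPn ns; apply/asboolP; apply: contrapT => nt; apply: ne.
  by apply/propext; split.
- by have [] := prefix _ _ lts; exists ((val t).1, true), true.
Qed.
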